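(* Let $\mathcal{D}$ be a triangulated category and $(\mathcal{D}^{\leq 0},\mathcal{D}^{\geq 1})$ a $t$-structure on $\mathcal{D}$ with heart $\mathcal{H}$. There exist bijective correspondences between (1) the set of wide subcategories of $\mathcal{H}$, and (2) the set of homology-determined thick subcategories of $\mathcal{D}$. In the correspondence from (1) to (2), a wide subcategory $\mathcal{W}$ corresponds to the subcategory $\widetilde{\mathcal{W}}=\{X\in\mathcal{D}\mid H^kX\in\mathcal{W}\text{ for all }k\in\mathbb{Z}\}$, and its inverse is given by $\mathcal{E}\mapsto H^0\mathcal{E}$. Moreover, if $(\mathcal{D}^{\leq 0},\mathcal{D}^{\geq 1})$ is bounded, the set (2) equals (3) the set of $H^0$-stable thick subcategories of $\mathcal{D}$.
   Context: All subcategories are full, additive and closed under isomorphisms. A subcategory of an abelian category is wide if it is closed under extensions, kernels and cokernels. For a $t$-structure $(\mathcal{D}^{\leq 0},\mathcal{D}^{\geq 1})$ put $\mathcal{D}^{\leq n}=\mathcal{D}^{\leq 0}[-n]$, $\mathcal{D}^{\geq n+1}=\mathcal{D}^{\geq 1}[-n]$; the heart is $\mathcal{H}=\mathcal{D}^{\leq 0}\cap\mathcal{D}^{\geq 0}$, $H^0\colon\mathcal{D}\to\mathcal{H}$ is the associated cohomological functor, and $H^kX=H^0(X[k])$. For a subcategory $\mathcal{E}$, $H^0\mathcal{E}$ is the subcategory of $\mathcal{H}$ of objects isomorphic to $H^0X$ with $X\in\mathcal{E}$. The $t$-structure is bounded if $\bigcup_{n\in\mathbb{Z}}\mathcal{D}^{\leq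 n}=\mathcal{D}=\bigcup_{n\in\mathbb{Z}}\mathcal{D}^{\geq n}$. A subcategory $\mathcal{U}$ of $\mathcal{D}$ is homology-determined if for every $X\in\mathcal{D}$: $X\in\mathcal{U}$ if and only if $H^kX\in\mathcal{U}[k]$ for all $k\in\mathbb{Z}$. A subcategory $\mathcal{E}$ of $\mathcal{D}$ is $H^0$-stable if $H^0X\in\mathcal{E}$ for all $X\in\mathcal{E}$. Thick means: triangulated subcategory closed under direct summands. *)

(* Defs.v *)
From mathcomp Require Import all_boot all_order all_algebra.
From mathcomp Require Import boolp classical_sets functions.

Set Implicit Arguments.
Unset Strict Implicit.
Unset Printing Implicit Defensive.

Import GRing.Theory.
Local Open Scope classical_set_scope.
Local Open Scope ring_scope.

(** * Preadditive categories *)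

(** The choice structure that [zmodType] puts on hom-groups always exists
    classically, so it is no restriction on the category. *)

Record preadditive := Preadditive {
  obj :> Type;
  hom : obj -> obj -> zmodType;
  idm : forall X : obj, hom X X;
  compm : forall X Y Z : obj, hom Y Z -> hom X Y -> hom X Z;
  compA : forall (X Y Z W : obj) (h : hom Z W) (g : hom Y Z) (f : hom X Y),
    compm h (compm g f) = compm (compm h g) f;
  comp1m : forall (X Y : obj) (f : hom X Y), compm (idm Y) f = f;
  compm1 : forall (X Y : obj) (f : hom X Y), compm f (idm X) = f;
  compDl : forall (X Y Z : obj) (g g' : hom Y Z) (f : hom X Y),
    compm (g + g') f = compm g f + compm g' f;
  compDr : forall (X Y Z : obj) (g : hom Y Z) (f f' : hom X Y),
    compm g (f + f') = compm g f + compm g f'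
}.

Arguments idm {p} X.
Arguments compm {p X Y Z} g f.

Notation "g \oc f" := (compm g f) (at level 40, left associativity).

Section Preadditive.
Variable C : preadditive.

Definition is_iso (X Y : C) (f : hom X Y) : Prop :=
  exists g : hom Y X, g \oc f = idm X /\ f \oc g = idm Y.

Definition isomorphic (X Y : C) : Prop := exists f : hom X Y, is_iso f.

Definition zero_obj (Z : C) : Prop :=
  forall X : C, (forall f : hom X Z, f = 0) /\ (forall f : hom Z X, f = 0).

Definition direct_sum (X Y S : C) : Prop :=
  exists (i1 : hom X S) (i2 : hom Y S) (p1 : hom S X) (p2 : hom S Y),
    [/\ p1 \oc i1 = idm X, p2 \oc i2 = idm Y, p1 \oc i2 = 0, p2 \oc i1 = 0 &
        i1 \oc p1 + i2 \oc p2 = idm S].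

Definition additive : Prop :=
  (exists Z : C, zero_obj Z) /\ (forall X Y : C, exists S : C, direct_sum X Y S).

(** A full subcategory is given by its set of objects; as a standing convention
    subcategories are additive and closed under isomorphisms. *)
Record is_subcat (E : set C) : Prop := IsSubcat {
  subcat_iso : forall X Y : C, isomorphic X Y -> E X -> E Y;
  subcat_zero : exists2 Z : C, zero_obj Z & E Z;
  subcat_sum : forall X Y S : C, direct_sum X Y S -> E X -> E Y -> E S
}.

Definition is_kernel (X Y : C) (f : hom X Y) (K : C) (k : hom K X) : Prop :=
  f \oc k = 0 /\
  forall (T : C) (t : hom T X), f \oc t = 0 -> exists! u : hom T K, k \oc u = t.

Definition is_cokernel (X Y : C) (f : hom X Y) (Q : C) (q : hom Y Q) : Prop :=
  q \oc f = 0 /\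
  forall (T : C) (t : hom Y T), t \oc f = 0 -> exists! u : hom Q T, u \oc q = t.

Definition short_exact (X Y Z : C) (f : hom X Y) (g : hom Y Z) : Prop :=
  is_kernel g f /\ is_cokernel f g.

Record wide (W : set C) : Prop := Wide {
  wide_subcat : is_subcat W;
  wide_ext : forall (X Y Z : C) (f : hom X Y) (g : hom Y Z),
    short_exact f g -> W X -> W Z -> W Y;
  wide_ker : forall (X Y : C) (f : hom X Y) (K : C) (k : hom K X),
    is_kernel f k -> W X -> W Y -> W K;
  wide_coker : forall (X Y : C) (f : hom X Y) (Q : C) (q : hom Y Q),
    is_cokernel f q -> W X -> W Y -> W Q
}.

Section FullSubcategory.
Variable P : set C.
Let O := {X : C | P X}.
Let homO (X Y : O) := hom (sval X) (sval Y).

Definition full_subcat : preadditive :=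
  @Preadditive O homO (fun X => idm (sval X))
    (fun X Y Z (g : homO Y Z) (f : homO X Y) => g \oc f)
    (fun X Y Z W h g f => compA h g f)
    (fun X Y f => comp1m f) (fun X Y f => compm1 f)
    (fun X Y Z g g' f => compDl g g' f) (fun X Y Z g f f' => compDr g f f').

End FullSubcategory.
End Preadditive.

(** * Additive functors *)

Record add_functor (C D : preadditive) := AddFunctor {
  fobj :> C -> D;
  fmap : forall X Y : C, hom X Y -> hom (fobj X) (fobj Y);
  fmap_id : forall X : C, fmap (idm X) = idm (fobj X);
  fmap_comp : forall (X Y Z : C) (g : hom Y Z) (f : hom X Y),
    fmap (g \oc f) = fmap g \oc fmap f;
  fmapD : forall (X Y : C) (f g : hom X Y), fmap (f + g) = fmap f + fmap g
}.

Arguments fmap {C D} a {X Y} f.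

(** [F] and [G] are mutually quasi-inverse equivalences. *)
Definition quasi_inverse (C D : preadditive)
    (F : add_functor C D) (G : add_functor D C) : Prop :=
  (exists e : forall X : C, hom (G (F X)) X,
     (forall X, is_iso (e X)) /\
     (forall (X Y : C) (f : hom X Y), e Y \oc fmap G (fmap F f) = f \oc e X)) /\
  (exists e : forall X : D, hom (F (G X)) X,
     (forall X, is_iso (e X)) /\
     (forall (X Y : D) (f : hom X Y), e Y \oc fmap F (fmap G f) = f \oc e X)).

(** * Triangulated categories *)

Record triangulated := Triangulated {
  tcat :> preadditive;
  tcat_additive : additive tcat;
  sh : add_functor tcat tcat;
  shV : add_functor tcat tcat;
  sh_equiv : quasi_inverse sh shV;
  dist : forall X Y Z : tcat, hom X Y -> hom Y Z -> hom Z (sh X) -> Prop;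
  dist_iso : forall (X Y Z X' Y' Z' : tcat)
      (f : hom X Y) (g : hom Y Z) (h : hom Z (sh X))
      (f' : hom X' Y') (g' : hom Y' Z') (h' : hom Z' (sh X'))
      (a : hom X X') (b : hom Y Y') (c : hom Z Z'),
    is_iso a -> is_iso b -> is_iso c ->
    b \oc f = f' \oc a -> c \oc g = g' \oc b -> fmap sh a \oc h = h' \oc c ->
    dist f g h -> dist f' g' h';
  dist_id : forall X Z : tcat, zero_obj Z ->
    dist (idm X) (0 : hom X Z) (0 : hom Z (sh X));
  dist_ex : forall (X Y : tcat) (f : hom X Y),
    exists (Z : tcat) (g : hom Y Z) (h : hom Z (sh X)), dist f g h;
  dist_rot : forall (X Y Z : tcat)
      (f : hom X Y) (g : hom Y Z) (h : hom Z (sh X)),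
    dist f g h <-> dist g h (- fmap sh f);
  dist_mor : forall (X Y Z X' Y' Z' : tcat)
      (f : hom X Y) (g : hom Y Z) (h : hom Z (sh X))
      (f' : hom X' Y') (g' : hom Y' Z') (h' : hom Z' (sh X'))
      (a : hom X X') (b : hom Y Y'),
    dist f g h -> dist f' g' h' -> b \oc f = f' \oc a ->
    exists c : hom Z Z', c \oc g = g' \oc b /\ fmap sh a \oc h = h' \oc c;
  dist_oct : forall (X Y Z Z' X' Y' : tcat) (f : hom X Y) (g : hom Y Z)
      (f1 : hom Y Z') (f2 : hom Z' (sh X))
      (g1 : hom Z X') (g2 : hom X' (sh Y))
      (h1 : hom Z Y') (h2 : hom Y' (sh X)),
    dist f f1 f2 -> dist g g1 g2 -> dist (g \oc f) h1 h2 ->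
    exists (u : hom Z' Y') (v : hom Y' X'),
      [/\ dist u v (fmap sh f1 \oc g2),
          u \oc f1 = h1 \oc g, h2 \oc u = f2,
          v \oc h1 = g1 & g2 \oc v = fmap sh f \oc h2]
}.

Section Triangulated.
Variable D : triangulated.

(** The object X[n]. The shift is only assumed to be an equivalence, so negative
    shifts use the quasi-inverse and X[m][n] is X[m+n] up to isomorphism. *)
Definition shift (n : int) (X : D) : D :=
  match n with
  | Posz m => iter m (sh D) X
  | Negz m => iter m.+1 (shV D) X
  end.

Definition shift_sub (E : set D) (n : int) : set D :=
  [set X | exists2 Y : D, E Y & isomorphic X (shift n Y)].

Record thick (E : set D) : Prop := Thick {
  thick_subcat : is_subcat E;
  thick_shift : forall (n : int) (X : D), E X -> E (shift n X);
  thick_cone : forall (X Y Z : D)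
      (f : hom X Y) (g : hom Y Z) (h : hom Z (sh D X)),
    dist f g h -> E X -> E Y -> E Z;
  thick_summand : forall X Y S : D, direct_sum X Y S -> E S -> E X
}.

End Triangulated.

(** * t-structures *)

Record tstructure (D : triangulated) := TStructure {
  Dle0 : set D;
  Dge1 : set D;
  Dle0_subcat : is_subcat Dle0;
  Dge1_subcat : is_subcat Dge1;
  t_orth : forall (X Y : D) (f : hom X Y), Dle0 X -> Dge1 Y -> f = 0;
  Dle0_shift : forall X : D, Dle0 X -> Dle0 (shift 1 X);
  Dge1_shift : forall X : D, Dge1 X -> Dge1 (shift (-1) X);
  t_trunc : forall X : D, exists (A B : D),
    [/\ Dle0 A, Dge1 B &
        exists (f : hom A X) (g : hom X B) (h : hom B (sh D A)), dist f g h]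
}.

Section TStructure.
Variables (D : triangulated) (t : tstructure D).

Definition Dle (n : int) : set D := shift_sub (Dle0 t) (- n).
Definition Dge (n : int) : set D := shift_sub (Dge1 t) (1 - n).

Definition bounded : Prop :=
  \bigcup_n Dle n = setT /\ \bigcup_n Dge n = setT.

Definition heart : preadditive := full_subcat (Dle 0 `&` Dge 0).

(** The truncations, by choice of a truncation triangle
    [tau_le0 X -> X -> tau_ge1 X ->] for each object [X]. *)
Definition tau_le0 (X : D) : D := sval (cid (t_trunc t X)).
Definition tau_ge1 (X : D) : D := sval (cid (svalP (cid (t_trunc t X)))).

Lemma tau_spec (X : D) :
  [/\ Dle0 t (tau_le0 X), Dge1 t (tau_ge1 X) &
      exists (f : hom (tau_le0 X) X) (g : hom X (tau_ge1 X))
             (h : hom (tau_ge1 X) (sh D (tau_le0 X))), dist f g h].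
Proof. exact: (svalP (cid (svalP (cid (t_trunc t X))))). Qed.

Definition tau_ge0 (X : D) : D := shift 1 (tau_ge1 (shift (-1) X)).

End TStructure.

(** ** The object [tau_ge0 (tau_le0 X)] lies in the heart *)

Section Basics.
Variable C : preadditive.

Lemma comp0m (X Y Z : C) (f : hom X Y) : (0 : hom Y Z) \oc f = 0.
Proof. by apply: (addrI ((0 : hom Y Z) \oc f)); rewrite -compDl !addr0. Qed.

Lemma compm0 (X Y Z : C) (g : hom Y Z) : g \oc (0 : hom X Y) = 0.
Proof. by apply: (addrI (g \oc (0 : hom X Y))); rewrite -compDr !addr0. Qed.

Lemma compNm (X Y Z : C) (g : hom Y Z) (f : hom X Y) :
  (- g) \oc f = - (g \oc f).
Proof. by apply: (addrI (g \oc f)); rewrite -compDl !subrr comp0m. Qed.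

Lemma compmN (X Y Z : C) (g : hom Y Z) (f : hom X Y) :
  g \oc (- f) = - (g \oc f).
Proof. by apply: (addrI (g \oc f)); rewrite -compDr !subrr compm0. Qed.

Lemma zero_objP (Z : C) : zero_obj Z <-> idm Z = 0.
Proof.
split=> [Z0|Z0 X]; first exact: (Z0 Z).1.
by split=> f; [rewrite -[f]comp1m Z0 comp0m | rewrite -[f]compm1 Z0 compm0].
Qed.

Lemma is_iso_id (X : C) : is_iso (idm X).
Proof. by exists (idm X); rewrite !comp1m. Qed.

End Basics.

Section FunctorBasics.
Variables C C' : preadditive.

Lemma fmap0 (F : add_functor C C') (X Y : C) :
  fmap F (0 : hom X Y) = 0.
Proof.
by apply: (addrI (fmap F (0 : hom X Y))); rewrite -fmapD !addr0.
Qed.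

Lemma fmapN (F : add_functor C C') (X Y : C) (f : hom X Y) :
  fmap F (- f) = - fmap F f.
Proof. by apply: (addrI (fmap F f)); rewrite -fmapD !subrr fmap0. Qed.

Lemma fmap_zero_obj (F : add_functor C C') (Z : C) :
  zero_obj Z -> zero_obj (F Z).
Proof. by move=> /zero_objP Z0; apply/zero_objP; rewrite -fmap_id Z0 fmap0. Qed.

End FunctorBasics.

Section TriangleLemmas.
Variable D : triangulated.

Lemma dist_comp0 (X Y Z : D) (f : hom X Y) (g : hom Y Z) (h : hom Z (sh D X)) :
  dist f g h -> g \oc f = 0.
Proof.
move=> fgh; have [[O O0] _] := tcat_additive D.
have [//|c [<- _]] := dist_mor (dist_id X O0) fgh (b := f) (a := idm X).
by rewrite compm0.
Qed.

Lemma dist_0id (X O : D) : zero_obj O ->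
  dist (0 : hom O X) (idm X) (0 : hom X (sh D O)).
Proof.
move=> O0; apply/dist_rot; rewrite fmap0 oppr0.
exact/dist_id/fmap_zero_obj.
Qed.

Lemma dist_wcoker (X Y Z W : D) (f : hom X Y) (g : hom Y Z)
    (h : hom Z (sh D X)) (u : hom Y W) :
  dist f g h -> u \oc f = 0 -> exists v : hom Z W, v \oc g = u.
Proof.
move=> fgh uf0; have [[O O0] _] := tcat_additive D.
have [|c [cg _]] := dist_mor fgh (dist_0id W O0) (a := 0) (b := u).
  by rewrite uf0 comp0m.
by exists c; rewrite cg comp1m.
Qed.

Lemma sh_reflects_iso (X Y : D) (f : hom X Y) : is_iso (fmap (sh D) f) -> is_iso f.
Proof.
move=> [g [gf fg]]; have [[e [eI eN]] _] := sh_equiv D.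
have [[i [iX Xi]] [j [jY Yj]]] := (eI X, eI Y).
exists (e X \oc fmap (shV D) g \oc j); split.
  have -> : f = e Y \oc fmap (shV D) (fmap (sh D) f) \oc i.
    by rewrite eN -compA Xi compm1.
  rewrite !compA -[e X \oc _ \oc j \oc e Y]compA jY compm1.
  by rewrite -[e X \oc _ \oc _]compA -fmap_comp gf fmap_id compm1.
have -> : f = e Y \oc fmap (shV D) (fmap (sh D) f) \oc i.
  by rewrite eN -compA Xi compm1.
rewrite -!compA [i \oc _]compA iX comp1m [fmap _ _ \oc (_ \oc _)]compA.
by rewrite -fmap_comp fg fmap_id comp1m.
Qed.

Lemma dist_cone0_iso (X Y Z : D) (f : hom X Y) (g : hom Y Z)
    (h : hom Z (sh D X)) :
  dist f g h -> zero_obj Z -> is_iso f.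
Proof.
move=> fgh Z0; apply: sh_reflects_iso.
have d1 := (dist_rot f g h).1 fgh.
have d2 := (dist_rot _ _ _).1 d1.
have d3 := (dist_rot _ _ _).1 d2.
have [|v] := dist_wcoker (u := idm (sh D X)) d2.
  by rewrite ((Z0 _).2 h) compm0.
rewrite compmN -compNm => vf; exists (- v); split => //.
have [|w wE] := dist_wcoker (u := fmap (sh D) f \oc (- v) - idm _) d3.
  by rewrite compmN compDl compNm -compA vf compm1 comp1m subrr oppr0.
have sg0 : fmap (sh D) g = 0 by apply: (fmap_zero_obj (sh D) Z0 _).1.
by apply/eqP; rewrite -subr_eq0 -wE sg0 oppr0 compm0.
Qed.

Lemma Dle0_ext (t : tstructure D) (X Y Z : D)
    (f : hom X Y) (g : hom Y Z) (h : hom Z (sh D X)) :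
  dist f g h -> Dle0 t X -> Dle0 t Z -> Dle0 t Y.
Proof.
move=> fgh tX tZ; have [tA tB [a [b [c abc]]]] := tau_spec t Y.
have b0 : b = 0.
  have [|v <-] := dist_wcoker (u := b) fgh.
    exact: t_orth tX tB.
  by rewrite (t_orth v tZ tB) comp0m.
have B0 : zero_obj (tau_ge1 t Y).
  apply/zero_objP.
  have [|v <-] := dist_wcoker (u := idm _) ((dist_rot _ _ _).1 abc).
    by rewrite b0 compm0.
  by rewrite (t_orth v (Dle0_shift tA) tB) comp0m.
apply: subcat_iso (Dle0_subcat t) _ _ _ tA.
by exists a; exact: dist_cone0_iso abc B0.
Qed.

Lemma isomorphic_sym (C : preadditive) (X Y : C) :
  isomorphic X Y -> isomorphic Y X.
Proof. by move=> [f [g [gf fg]]]; exists g, f. Qed.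

Lemma tau_ge0_Dle0 (t : tstructure D) (Y : D) :
  Dle0 t Y -> Dle0 t (tau_ge0 t Y).
Proof.
move=> tY; have [tA _ [f [g [h fgh]]]] := tau_spec t (shift (-1) Y).
have d3 := (dist_rot _ _ _).1 ((dist_rot _ _ _).1 ((dist_rot _ _ _).1 fgh)).
apply: Dle0_ext ((dist_rot _ _ _).1 d3) _ (Dle0_shift (Dle0_shift tA)).
have [_ [e [eI _]]] := sh_equiv D.
apply: subcat_iso (Dle0_subcat t) _ _ _ tY.
by apply: isomorphic_sym; exists (e Y); exact: eI.
Qed.

End TriangleLemmas.

(** * Cohomology and the subcategories of the heart *)

Section Cohomology.
Variables (D : triangulated) (t : tstructure D).

Lemma H0_in_heart (X : D) : (Dle t 0 `&` Dge t 0) (tau_ge0 t (tau_le0 t X)).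
Proof.
split.
  exists (tau_ge0 t (tau_le0 t X)).
    by apply: tau_ge0_Dle0; have [] := tau_spec t X.
  by rewrite oppr0; exists (idm _); exact: is_iso_id.
exists (tau_ge1 t (shift (-1) (tau_le0 t X))).
  by have [] := tau_spec t (shift (-1) (tau_le0 t X)).
by rewrite subr0; exists (idm _); exact: is_iso_id.
Qed.

(** The cohomological functor on objects, [D -> heart]. *)
Definition H0 (X : D) : heart t := exist _ _ (H0_in_heart X).

Definition Hn (k : int) (X : D) : heart t := H0 (shift k X).

(** The inclusion of the heart. *)
Definition incl (M : heart t) : D := sval M.

Definition H0_sub (E : set D) : set (heart t) :=
  [set M | exists2 X : D, E X & isomorphic M (H0 X)].

Definition tilde (W : set (heart t)) : set D :=
  [set X | forall k : int, W (Hn k X)].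

Definition homology_determined (U : set D) : Prop :=
  forall X : D, U X <-> forall k : int, shift_sub U k (incl (Hn k X)).

Definition H0_stable (E : set D) : Prop :=
  forall X : D, E X -> E (incl (H0 X)).

End Cohomology.

Arguments H0_sub {D} t E.
Arguments tilde {D} t W.

(* Main.v *)
From mathcomp Require Import all_boot all_algebra.
From mathcomp Require Import boolp classical_sets functions.
Require Import Defs.

Set Implicit Arguments.
Unset Strict Implicit.
Unset Printing Implicit Defensive.

Import GRing.Theory.
Local Open Scope classical_set_scope.
Local Open Scope ring_scope.

(** The cohomology of an object [X] in degree 0 is presented by a self-dual square
    (see [square]) made of the two truncations of [X] and of [M = H0 X]. Orthogonality
    of the two halves of the t-structure makes every map of [D] induce a unique map on
    the corners [M] of any two squares, which turns [H0] into an additive functor.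

    This functor is half exact in two situations. For a triangle
    [X -> Y -> Z ->], if [X] lies in degrees at most 0 then [H0 Z] is the cokernel of
    [H0 X -> H0 Y] ([induced_cokernel]), and if [Z] lies in degrees at least 0 then
    [H0 X] is the kernel of [H0 Y -> H0 Z] ([induced_kernel]). Each of these is one
    octahedron. Truncating [X] and [Y] in a general triangle reduces to the two cases:
    [H0 Z] is an extension of the kernel of [H0 X[1] -> H0 Y[1]] by the cokernel of
    [H0 X -> H0 Y] ([H0_cone]). Hence
    the objects with cohomology in a wide subcategory [W] form a thick subcategory
    ([tilde_thick]), and since an object of the heart has cohomology only in degree 0,
    [W] is recovered from it ([H0_sub_tilde]).

    Conversely let [E] be thick and stable under [H0]. Then [H0_sub t E] consists of
    the objects of the heart that lie in [E]. A map of the heart has its kernel and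
    its cokernel equal to [H0] of its fibre and of its cone, and a short exact sequence
    of the heart is a triangle, so this subcategory is wide ([H0_sub_wide]). If [E] is
    homology-determined, then [E] is the class of objects with cohomology in it
    ([tilde_H0_sub]). Over a bounded t-structure stability under [H0] suffices: an
    object with cohomology in [E] is built from its finitely many cohomology objects
    by triangles ([stable_amplitude]). *)

(** * Preadditive categories and functors *)

Section PreadditiveFacts.
Variable C : preadditive.

Lemma compBr (X Y Z : C) (g : hom Y Z) (f f' : hom X Y) :
  g \oc (f - f') = g \oc f - g \oc f'.
Proof. by rewrite compDr compmN. Qed.

Lemma compBl (X Y Z : C) (g g' : hom Y Z) (f : hom X Y) :
  (g - g') \oc f = g \oc f - g' \oc f.
Proof. by rewrite compDl compNm. Qed.

Lemma iso_refl (X : C) : isomorphic X X.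
Proof. by exists (idm X); exact: is_iso_id. Qed.

Lemma iso_trans (X Y Z : C) : isomorphic X Y -> isomorphic Y Z -> isomorphic X Z.
Proof.
move=> [f [f' [f'f ff']]] [g [g' [g'g gg']]].
exists (g \oc f), (f' \oc g'); split.
  by rewrite compA -[f' \oc g' \oc g]compA g'g compm1.
by rewrite compA -[g \oc f \oc f']compA ff' compm1.
Qed.

Lemma is_iso_opp_id (X : C) : is_iso (- idm X).
Proof. by exists (- idm X); rewrite compNm compmN opprK comp1m. Qed.

Lemma iso_monic (X Y W : C) (f : hom X Y) (u v : hom W X) :
  is_iso f -> f \oc u = f \oc v -> u = v.
Proof. by move=> [g [gf _]] E; rewrite -[u]comp1m -[v]comp1m -gf -!compA E. Qed.

Lemma iso_epic (X Y W : C) (f : hom X Y) (u v : hom Y W) :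
  is_iso f -> u \oc f = v \oc f -> u = v.
Proof. by move=> [g [_ fg]] E; rewrite -[u]compm1 -[v]compm1 -fg !compA E. Qed.

Lemma zero_obj_iso (X Y : C) : zero_obj X -> zero_obj Y -> isomorphic X Y.
Proof.
move=> /zero_objP X0 /zero_objP Y0; exists 0, 0.
by rewrite !comp0m X0 Y0.
Qed.

Lemma subcat_zero_obj (E : set C) (Z : C) : is_subcat E -> zero_obj Z -> E Z.
Proof.
move=> sE Z0; have [O O0 EO] := subcat_zero sE.
exact: (subcat_iso sE (zero_obj_iso O0 Z0) EO).
Qed.

Lemma kernel_unique (X Y K K' : C) (f : hom X Y) (k : hom K X) (k' : hom K' X) :
  is_kernel f k -> is_kernel f k' -> isomorphic K K'.
Proof.
move=> [fk uk] [fk' uk'].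
have [u [uE _]] := uk' _ _ fk; have [v [vE _]] := uk _ _ fk'.
exists u, v; split.
  have [w [_ wU]] := uk _ _ fk.
  by rewrite -(wU (v \oc u)) ?compA ?vE // (wU (idm K)) ?compm1.
have [w [_ wU]] := uk' _ _ fk'.
by rewrite -(wU (u \oc v)) ?compA ?uE // (wU (idm K')) ?compm1.
Qed.

Lemma cokernel_unique (X Y Q Q' : C) (f : hom X Y) (q : hom Y Q) (q' : hom Y Q') :
  is_cokernel f q -> is_cokernel f q' -> exists2 u : hom Q Q', is_iso u & u \oc q = q'.
Proof.
move=> [qf uq] [qf' uq'].
have [u [uE _]] := uq _ _ qf'; have [v [vE _]] := uq' _ _ qf.
exists u => //; exists v; split.
  have [w [_ wU]] := uq _ _ qf.
  by rewrite -(wU (v \oc u)) -?compA ?uE // (wU (idm Q)) ?comp1m.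
have [w [_ wU]] := uq' _ _ qf'.
by rewrite -(wU (u \oc v)) -?compA ?vE // (wU (idm Q')) ?comp1m.
Qed.

(** A summand is the kernel of the projector on the other summand, so a subcategory
    closed under kernels is closed under summands. *)
Lemma direct_sum_kernel (X Y S : C) : direct_sum X Y S ->
  exists (e : hom S S) (i : hom X S), is_kernel e i.
Proof.
move=> [i1 [i2 [p1 [p2 [p1i1 p2i2 p1i2 p2i1 ipE]]]]].
exists (i2 \oc p2), i1; split; first by rewrite -compA p2i1 compm0.
move=> T s es0; exists (p1 \oc s); split=> [|u <-].
  by rewrite -[s in RHS]comp1m -ipE compDl es0 addr0 compA.
by rewrite compA p1i1 comp1m.
Qed.

End PreadditiveFacts.

Section FunctorFacts.
Variables (C C' : preadditive).

Lemma fmap_is_iso (F : add_functor C C') (X Y : C) (f : hom X Y) :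
  is_iso f -> is_iso (fmap F f).
Proof.
by move=> [g [gf fg]]; exists (fmap F g); rewrite -!fmap_comp gf fg !fmap_id.
Qed.

Lemma fmap_isomorphic (F : add_functor C C') (X Y : C) :
  isomorphic X Y -> isomorphic (F X) (F Y).
Proof. by move=> [f fI]; exists (fmap F f); exact: fmap_is_iso. Qed.

Lemma fmap_direct_sum (F : add_functor C C') (X Y S : C) :
  direct_sum X Y S -> direct_sum (F X) (F Y) (F S).
Proof.
move=> [i1 [i2 [p1 [p2 [p1i1 p2i2 p1i2 p2i1 ipE]]]]].
exists (fmap F i1), (fmap F i2), (fmap F p1), (fmap F p2).
by rewrite -!fmap_comp p1i1 p2i2 p1i2 p2i1 -fmapD ipE !fmap_id !fmap0.
Qed.

Lemma quasi_inverse_faithful (F : add_functor C C') (G : add_functor C' C) :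
  quasi_inverse F G -> forall (X Y : C) (f g : hom X Y),
  fmap F f = fmap F g -> f = g.
Proof.
move=> [[e [eI eN]] _] X Y f g fg.
by apply: (iso_epic (eI X)); rewrite -!eN fg.
Qed.

Lemma quasi_inverse_sym (F : add_functor C C') (G : add_functor C' C) :
  quasi_inverse F G -> quasi_inverse G F.
Proof. by case. Qed.

End FunctorFacts.

(** The candidate [f] is conjugate to [G g]; since [G] is faithful, [F f = g] may be
    checked after applying [G]. *)
Lemma quasi_inverse_full (C C' : preadditive) (F : add_functor C C')
    (G : add_functor C' C) : quasi_inverse F G ->
  forall (X Y : C) (g : hom (F X) (F Y)), exists f : hom X Y, fmap F f = g.
Proof.
move=> FG X Y g; have [[e [eI eN]] _] := FG.
have [i [iX Xi]] := eI X; exists (e Y \oc fmap G g \oc i).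
apply: (quasi_inverse_faithful (quasi_inverse_sym FG)).
by apply: (iso_monic (eI Y)); rewrite eN -compA iX compm1.
Qed.

(** * Triangulated categories *)

Section TriangulatedFacts.
Variable D : triangulated.

Lemma sh_faithful (X Y : D) (f g : hom X Y) :
  fmap (sh D) f = fmap (sh D) g -> f = g.
Proof. exact: (quasi_inverse_faithful (sh_equiv D)). Qed.

Lemma sh_full (X Y : D) (g : hom (sh D X) (sh D Y)) :
  exists f : hom X Y, fmap (sh D) f = g.
Proof. exact: (quasi_inverse_full (sh_equiv D)). Qed.

Lemma sh_shV_iso (X : D) : isomorphic (sh D (shV D X)) X.
Proof. by have [_ [e [eI _]]] := sh_equiv D; exists (e X). Qed.

Lemma shV_sh_iso (X : D) : isomorphic (shV D (sh D X)) X.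
Proof. by have [[e [eI _]] _] := sh_equiv D; exists (e X). Qed.

(** The shifted triangle carries one sign; it comes from three rotations after
    removing a pair of signs by the automorphism [- idm] of the middle term. *)
Lemma dist_sh (X Y Z : D) (f : hom X Y) (g : hom Y Z) (h : hom Z (sh D X)) :
  dist f g h <->
  dist (fmap (sh D) f) (fmap (sh D) g) (- fmap (sh D) h).
Proof.
have -> : dist f g h <->
    dist (- fmap (sh D) f) (- fmap (sh D) g) (- fmap (sh D) h).
  apply: iff_trans (dist_rot _ _ _) _; apply: iff_trans (dist_rot _ _ _) _.
  exact: dist_rot.
split=> d; apply: dist_iso (is_iso_id _) (is_iso_opp_id _) (is_iso_id _) _ _ _ d;
  by rewrite ?(compNm, compmN, comp1m, compm1, fmap_id, opprK).
Qed.

(** Comparison with the rotated identity triangle of [W] gives the lift after one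
    shift, and the shift is full and faithful. *)
Lemma dist_wker (X Y Z W : D) (f : hom X Y) (g : hom Y Z) (h : hom Z (sh D X))
    (u : hom W Y) : dist f g h -> g \oc u = 0 -> exists v : hom W X, f \oc v = u.
Proof.
move=> fgh gu0; have [[O O0] _] := tcat_additive D.
have d1 := (dist_rot _ _ _).1 (dist_id W O0).
have [|c [_ cE]] := dist_mor d1 ((dist_rot _ _ _).1 fgh) (a := u) (b := 0).
  by rewrite gu0 comp0m.
have [v vE] := sh_full c; exists v; apply: sh_faithful.
move: cE; rewrite compmN compNm fmap_id compm1 -vE -fmap_comp.
by move/oppr_inj.
Qed.

(** The kernel of composition with [f] is the image of [hom W Z[-1]], which is
    written with the shift on the other side. *)
Lemma dist_monic (X Y Z W : D) (f : hom X Y) (g : hom Y Z) (h : hom Z (sh D X)) :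
  dist f g h -> (forall v : hom (sh D W) Z, v = 0) ->
  forall u v : hom W X, f \oc u = f \oc v -> u = v.
Proof.
move=> fgh WZ u v fuv; apply/eqP; rewrite -subr_eq0; apply/eqP.
have d2 := (dist_rot _ _ _).1 ((dist_rot _ _ _).1 fgh).
have [|w wE] := dist_wker (u := fmap (sh D) (u - v)) d2.
  by rewrite compNm -fmap_comp compBr fuv subrr fmap0 oppr0.
by apply: sh_faithful; rewrite fmap0 -wE (WZ w) compm0.
Qed.

Lemma dist_epic (X Y Z W : D) (f : hom X Y) (g : hom Y Z) (h : hom Z (sh D X)) :
  dist f g h -> (forall v : hom (sh D X) W, v = 0) ->
  forall u v : hom Z W, u \oc g = v \oc g -> u = v.
Proof.
move=> fgh XW u v uvg; apply/eqP; rewrite -subr_eq0; apply/eqP.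
have [|w <-] := dist_wcoker (u := u - v) ((dist_rot _ _ _).1 fgh).
  by rewrite compBl uvg subrr.
by rewrite (XW w) comp0m.
Qed.

Lemma dist_fiber (Y Z : D) (g : hom Y Z) :
  exists (X : D) (f : hom X Y) (h : hom Z (sh D X)), dist f g h.
Proof.
have [C [c [d gcd]]] := dist_ex g.
have [e [e' [e'e ee']]] := sh_shV_iso C.
have [k kE] := sh_full (d \oc e).
exists (shV D C), (- k), (e' \oc c); apply/dist_rot; rewrite fmapN opprK kE.
have e'I : is_iso e' by exists e.
apply: dist_iso (is_iso_id _) (is_iso_id _) e'I _ _ _ gcd.
- by rewrite comp1m compm1.
- by rewrite compm1.
- by rewrite fmap_id comp1m -compA ee' compm1.
Qed.

(** The octahedral axiom for fibres; it is the one for cones, one shift up. *)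
Lemma dist_oct_fiber (X Y Z F1 F2 F3 : D) (f : hom X Y) (g : hom Y Z)
    (i : hom F1 X) (i' : hom Y (sh D F1)) (k : hom F2 Y) (k' : hom Z (sh D F2))
    (l : hom F3 X) (l' : hom Z (sh D F3)) :
  dist i f i' -> dist k g k' -> dist l (g \oc f) l' ->
  exists (u : hom F1 F3) (v : hom F3 F2),
    [/\ dist u v (i' \oc k), l \oc u = i & k \oc v = f \oc l].
Proof.
move=> /dist_rot di /dist_rot dk /dist_rot dl.
have [u [v [duv _ lu _ kv]]] := dist_oct di dk dl.
have [u0 uE] := sh_full u; have [v0 vE] := sh_full v.
exists u0, v0; split.
- by apply/dist_sh; rewrite uE vE fmap_comp -compmN.
- apply: sh_faithful; rewrite fmap_comp uE.
  by apply: oppr_inj; rewrite -compNm.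
- apply: sh_faithful; rewrite !fmap_comp vE.
  by apply: oppr_inj; rewrite -compNm -compmN.
Qed.

Lemma dist_replace_cone (X Y Z Z' : D) (f : hom X Y) (g : hom Y Z) (h : hom Z (sh D X))
    (e : hom Z Z') : is_iso e -> dist f g h ->
  exists h' : hom Z' (sh D X), dist f (e \oc g) h'.
Proof.
move=> eI fgh; have [e' [e'e ee']] := eI.
exists (h \oc e'); apply: dist_iso (is_iso_id _) (is_iso_id _) eI _ _ _ fgh.
- by rewrite comp1m compm1.
- by rewrite compm1.
- by rewrite fmap_id comp1m -compA e'e compm1.
Qed.

Definition triangle_on (X Y Z : D) : Prop :=
  exists (f : hom X Y) (g : hom Y Z) (h : hom Z (sh D X)), dist f g h.

Lemma triangle_on_sh (X Y Z : D) :
  triangle_on X Y Z -> triangle_on (sh D X) (sh D Y) (sh D Z).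
Proof.
by move=> [f [g [h /dist_sh fgh]]]; do 3 eexists; exact: fgh.
Qed.

(** The octahedron on [f] followed by an identity. *)
Lemma cone_unique (X Y Z Z' : D) (f : hom X Y) (g : hom Y Z) (h : hom Z (sh D X))
    (g' : hom Y Z') (h' : hom Z' (sh D X)) :
  dist f g h -> dist f g' h' -> isomorphic Z Z'.
Proof.
move=> fgh; rewrite -{1}[f]comp1m => fgh'.
have [[O O0] _] := tcat_additive D.
have [u [v [duv _ _ _ _]]] := dist_oct fgh (dist_id Y O0) fgh'.
by exists u; exact: dist_cone0_iso duv O0.
Qed.

(** A negative shift is only a quasi-inverse, so the triangle is found by descending
    [f] along the shift and comparing cones. *)
Lemma triangle_on_shV (X Y Z : D) :
  triangle_on X Y Z -> triangle_on (shV D X) (shV D Y) (shV D Z).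
Proof.
move=> [f [g [h fgh]]].
have [[e eI] [k kI]] := (sh_shV_iso X, sh_shV_iso Y).
have [[e' [e'e ee']] [k' [k'k kk']]] := (eI, kI).
have [f' f'E] := sh_full (k' \oc f \oc e).
have [Z' [g' [h' /[dup] d /dist_sh d']]] := dist_ex f'.
have [c cI] : isomorphic Z' (shV D Z).
  apply: iso_trans (isomorphic_sym (shV_sh_iso _)) _; apply: fmap_isomorphic.
  apply: (cone_unique (g := fmap _ g' \oc k') (h := - (fmap _ e \oc fmap _ h'))) fgh.
  apply: dist_iso eI kI (is_iso_id _) _ _ _ d'.
  - by rewrite f'E !compA kk' comp1m.
  - by rewrite comp1m -compA k'k compm1.
  - by rewrite compm1 compmN.
by have [h'' d''] := dist_replace_cone cI d; do 3 eexists; exact: d''.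
Qed.

Lemma iso_shift (n : int) (X Y : D) :
  isomorphic X Y -> isomorphic (shift n X) (shift n Y).
Proof.
by rewrite /shift; case: n => n XY; [elim: n | elim: n.+1] => //= m; exact: fmap_isomorphic.
Qed.

Lemma shift_succ (n : int) (X : D) : isomorphic (shift (n + 1) X) (sh D (shift n X)).
Proof.
case: n => [n|[|n]]; first by rewrite -PoszD addn1; exact: iso_refl.
  exact/isomorphic_sym/sh_shV_iso.
have -> : (Negz n.+1 + 1 = Negz n)%R by rewrite !NegzE -addn1 PoszD opprD addrK.
exact/isomorphic_sym/sh_shV_iso.
Qed.

Lemma shift_pred (n : int) (X : D) : isomorphic (shift (n - 1) X) (shV D (shift n X)).
Proof.
apply: iso_trans (isomorphic_sym (shV_sh_iso _)) _; apply: fmap_isomorphic.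
by apply: isomorphic_sym; have := shift_succ (n - 1) X; rewrite subrK.
Qed.

Lemma shift_add (m n : int) (X : D) :
  isomorphic (shift m (shift n X)) (shift (m + n) X).
Proof.
elim/int_rec: m => [|m IH|m IH]; first by rewrite add0r; exact: iso_refl.
  apply: iso_trans (iso_trans (fmap_isomorphic _ IH) (isomorphic_sym (shift_succ _ _))) _.
  by rewrite addrAC -PoszD addn1; exact: iso_refl.
have -> : - m.+1%:Z = - m%:Z - 1 by rewrite -addn1 PoszD opprD.
rewrite addrAC; apply: iso_trans (shift_pred _ _) _.
exact: iso_trans (fmap_isomorphic _ IH) (isomorphic_sym (shift_pred _ _)).
Qed.

Lemma shiftK (n : int) (X : D) : isomorphic (shift n (shift (- n) X)) X.
Proof. by have := shift_add n (- n) X; rewrite subrr. Qed.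

Lemma triangle_on_shift (n : int) (X Y Z : D) :
  triangle_on X Y Z -> triangle_on (shift n X) (shift n Y) (shift n Z).
Proof.
by rewrite /shift; case: n => n XYZ; [elim: n | elim: n.+1] => //= m;
  [exact: triangle_on_sh | exact: triangle_on_shV].
Qed.

Lemma direct_sum_shift (n : int) (X Y S : D) :
  direct_sum X Y S -> direct_sum (shift n X) (shift n Y) (shift n S).
Proof.
by rewrite /shift; case: n => n XYS; [elim: n | elim: n.+1] => //= m; exact: fmap_direct_sum.
Qed.

Lemma zero_obj_shift (n : int) (X : D) : zero_obj X -> zero_obj (shift n X).
Proof.
by rewrite /shift; case: n => n X0; [elim: n | elim: n.+1] => //= m; exact: fmap_zero_obj.
Qed.

(** ** Thick subcategories *)

Section Thick.
Variables (E : set D) (tE : thick E).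

Lemma thick_iso (X Y : D) : isomorphic X Y -> E X -> E Y.
Proof. exact: subcat_iso (thick_subcat tE) _ _. Qed.

Lemma thick_shiftE (n : int) (X : D) : E (shift n X) <-> E X.
Proof.
split; last exact: thick_shift.
move=> /(thick_shift tE (- n)) EX; apply: thick_iso EX.
by have := shiftK (- n) X; rewrite opprK.
Qed.

Lemma thick_shift_sub (n : int) (X : D) : shift_sub E n X <-> E X.
Proof.
split=> [[Y EY XY]|EX].
  by apply: thick_iso (isomorphic_sym XY) _; exact/thick_shiftE.
by exists (shift (- n) X); [exact/thick_shiftE | exact/isomorphic_sym/shiftK].
Qed.

Lemma thick_fiber (X Y Z : D) (f : hom X Y) (g : hom Y Z) (h : hom Z (sh D X)) :
  dist f g h -> E Y -> E Z -> E X.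
Proof.
move=> /dist_rot fgh EY EZ; apply/(thick_shiftE 1).
exact: thick_cone tE _ _ _ _ _ _ fgh EY EZ.
Qed.

Lemma thick_middle (X Y Z : D) (f : hom X Y) (g : hom Y Z) (h : hom Z (sh D X)) :
  dist f g h -> E X -> E Z -> E Y.
Proof.
move=> /dist_rot fgh EX EZ; apply: (thick_fiber fgh EZ).
exact/(thick_shiftE 1).
Qed.

End Thick.

End TriangulatedFacts.
(** * Truncations *)

Section Aisles.
Variables (D : triangulated) (t : tstructure D).

Lemma Dle0E (X : D) : Dle t 0 X <-> Dle0 t X.
Proof.
rewrite /Dle oppr0; split=> [[Y tY XY]|tX]; last by exists X => //; exact: iso_refl.
exact: (subcat_iso (Dle0_subcat t) (isomorphic_sym XY)).
Qed.

Lemma DleN1E (X : D) :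
  Dle t (-1) X <-> exists2 Y, Dle0 t Y & isomorphic X (sh D Y).
Proof. by rewrite /Dle opprK. Qed.

Lemma Dge0E (X : D) :
  Dge t 0 X <-> exists2 Y, Dge1 t Y & isomorphic X (sh D Y).
Proof. by rewrite /Dge subr0. Qed.

Lemma Dle0_sh (X : D) : Dle0 t X -> Dle t (-1) (sh D X).
Proof. by move=> tX; apply/DleN1E; exists X => //; exact: iso_refl. Qed.

Lemma DleN1_le0 (X : D) : Dle t (-1) X -> Dle0 t X.
Proof.
move=> /DleN1E[Y tY XY].
exact: (subcat_iso (Dle0_subcat t) (isomorphic_sym XY) (Dle0_shift tY)).
Qed.

Lemma Dge1_sh (X : D) : Dge1 t X -> Dge t 0 (sh D X).
Proof. by move=> tX; apply/Dge0E; exists X => //; exact: iso_refl. Qed.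

Lemma Dge1_ge0 (X : D) : Dge1 t X -> Dge t 0 X.
Proof.
move=> tX; apply/Dge0E; exists (shV D X); first exact: Dge1_shift tX.
exact/isomorphic_sym/sh_shV_iso.
Qed.

Lemma orthN1 (X Y : D) (f : hom X Y) : Dle t (-1) X -> Dge t 0 Y -> f = 0.
Proof.
move=> /DleN1E[X' tX [i iI]] /Dge0E[Y' tY [j jI]].
have [i' [i'i ii']] := iI.
have [f' f'E] := sh_full (j \oc f \oc i').
apply: (iso_monic jI); rewrite compm0 -[j \oc f]compm1 -i'i compA -f'E.
by rewrite (t_orth f' tX tY) fmap0 comp0m.
Qed.

(** If no map from degrees at most 0 reaches [X], then the truncation [A -> X] is
    both zero and monic on such maps, so [A] is zero. *)
Lemma Dge1_of_orth (X : D) :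
  (forall (S : D) (f : hom S X), Dle0 t S -> f = 0) -> Dge1 t X.
Proof.
move=> oX; have [tA tB [a [b [d abd]]]] := tau_spec t X.
have A0 : zero_obj (tau_le0 t X).
  apply/zero_objP; apply: (dist_monic abd); last by rewrite (oX _ a tA) !comp0m.
  by move=> v; apply: t_orth tB; exact: Dle0_shift.
apply: (subcat_iso (Dge1_subcat t) _ tB); apply: isomorphic_sym.
exists b; apply: dist_cone0_iso ((dist_rot _ _ _).1 abd) _.
exact: fmap_zero_obj.
Qed.

Lemma Dge0_of_orth (X : D) :
  (forall (S : D) (f : hom S X), Dle t (-1) S -> f = 0) -> Dge t 0 X.
Proof.
move=> oX; apply/Dge0E; exists (shV D X); last exact/isomorphic_sym/sh_shV_iso.
apply: Dge1_of_orth => S f tS; have [e eI] := sh_shV_iso X.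
apply: sh_faithful; apply: (iso_monic eI); rewrite fmap0 compm0.
by apply: oX; exact: Dle0_sh.
Qed.

Lemma Dge0_iso (X Y : D) : isomorphic X Y -> Dge t 0 X -> Dge t 0 Y.
Proof.
move=> XY /Dge0E[Z tZ XZ]; apply/Dge0E; exists Z => //.
exact: iso_trans (isomorphic_sym XY) XZ.
Qed.

Lemma Dge0_ext (X Y Z : D) (f : hom X Y) (g : hom Y Z) (h : hom Z (sh D X)) :
  dist f g h -> Dge t 0 X -> Dge t 0 Z -> Dge t 0 Y.
Proof.
move=> fgh tX tZ; apply: Dge0_of_orth => S s tS.
have [|u <-] := dist_wker (u := s) fgh; first exact: orthN1.
by rewrite (orthN1 u tS tX) compm0.
Qed.

Lemma Dge0_fiber (X Y Z : D) (f : hom X Y) (g : hom Y Z) (h : hom Z (sh D X)) :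
  dist f g h -> Dge t 0 Y -> Dge t 0 Z -> Dge t 0 X.
Proof.
move=> fgh tY tZ; apply: Dge0_of_orth => S s tS.
apply: (dist_monic fgh) => [v|].
  by apply: (orthN1 v) tZ; apply: Dle0_sh; exact: DleN1_le0.
by rewrite compm0; exact: orthN1.
Qed.

Lemma Dle0_cone (X Y Z : D) (f : hom X Y) (g : hom Y Z) (h : hom Z (sh D X)) :
  dist f g h -> Dle0 t X -> Dle0 t Y -> Dle0 t Z.
Proof.
by move=> /dist_rot gh tX tY; exact: Dle0_ext gh tY (Dle0_shift tX).
Qed.

Lemma zero_obj_Dge1 (X : D) : zero_obj X -> Dge1 t X.
Proof. exact: subcat_zero_obj (Dge1_subcat t). Qed.

Lemma zero_obj_DleN1 (X : D) : zero_obj X -> Dle t (-1) X.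
Proof.
move=> X0; apply/DleN1E; exists X.
  exact: subcat_zero_obj (Dle0_subcat t) X0.
by apply: zero_obj_iso => //; exact: fmap_zero_obj.
Qed.

(** [a] exhibits [A] as the truncation of [X] to degrees at most 0. *)
Definition cover (A X : D) (a : hom A X) : Prop :=
  Dle0 t A /\
  exists (B : D) (b : hom X B) (d : hom B (sh D A)), Dge1 t B /\ dist a b d.

(** [c] exhibits [C] as the truncation of [X] to degrees at least 0. *)
Definition hull (X C : D) (c : hom X C) : Prop :=
  Dge t 0 C /\
  exists (P : D) (q : hom P X) (d : hom C (sh D P)), Dle t (-1) P /\ dist q c d.

Lemma cover_monic (S A X : D) (a : hom A X) (u v : hom S A) :
  cover a -> Dle0 t S -> a \oc u = a \oc v -> u = v.
Proof.
move=> [_ [B [b [d [tB abd]]]]] tS; apply: dist_monic abd _ _ _ => w.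
by apply: (t_orth w) tB; exact: Dle0_shift.
Qed.

Lemma cover_lift (S A X : D) (a : hom A X) (f : hom S X) :
  cover a -> Dle0 t S -> exists u, a \oc u = f.
Proof.
move=> [_ [B [b [d [tB abd]]]]] tS; apply: dist_wker abd _.
exact: t_orth tS tB.
Qed.

Lemma hull_epic (S X C : D) (c : hom X C) (u v : hom C S) :
  hull c -> Dge t 0 S -> u \oc c = v \oc c -> u = v.
Proof.
move=> [_ [P [q [d [tP qcd]]]]] tS; apply: dist_epic qcd _ _ _ => w.
by apply: (orthN1 w) tS; apply: Dle0_sh; exact: DleN1_le0.
Qed.

Lemma hull_lift (S X C : D) (c : hom X C) (f : hom X S) :
  hull c -> Dge t 0 S -> exists u, u \oc c = f.
Proof.
move=> [_ [P [q [d [tP qcd]]]]] tS; apply: dist_wcoker qcd _.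
exact: orthN1 tP tS.
Qed.

Lemma cover_id (X : D) : Dle0 t X -> cover (idm X).
Proof.
move=> tX; split=> //; have [[O O0] _] := tcat_additive D.
by exists O, 0, 0; split; [exact: zero_obj_Dge1 | exact: dist_id].
Qed.

Lemma hull_id (X : D) : Dge t 0 X -> hull (idm X).
Proof.
move=> tX; split=> //; have [[O O0] _] := tcat_additive D.
by exists O, 0, 0; split; [exact: zero_obj_DleN1 | exact: dist_0id].
Qed.

Lemma tau_cover (X : D) : exists a : hom (tau_le0 t X) X, cover a.
Proof.
have [tA tB [a [b [d abd]]]] := tau_spec t X.
by exists a; split=> //; exists (tau_ge1 t X), b, d.
Qed.

Lemma tau_hull (X : D) : exists c : hom X (tau_ge0 t X), hull c.
Proof.
have [tA tB [a [b [d /dist_sh abd]]]] := tau_spec t (shift (-1) X).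
have [e eI] := sh_shV_iso X; have [e' [e'e ee']] := eI.
exists (fmap (sh D) b \oc e'); split; first exact: Dge1_sh.
exists (sh D (tau_le0 t (shift (-1) X))), (e \oc fmap (sh D) a), (- fmap (sh D) d).
split; first exact: Dle0_sh.
apply: dist_iso (is_iso_id _) eI (is_iso_id _) _ _ _ abd.
- by rewrite compm1.
- by rewrite comp1m -compA e'e compm1.
- by rewrite fmap_id comp1m compm1.
Qed.

(** * Cohomology squares *)

(** The two ways of truncating [X] to degree 0 fit in one square
[[
      A --a--> X
      |p       |c
      M --j--> C
]]
    with [A] and [C] its truncations to degrees at most and at least 0. Since the
    square is self-dual it serves quotients of [X] as well as subobjects, and since
    it determines [M] up to unique isomorphism any square can be used in place of
    the chosen object [H0 X]. *)
Record square (X M : D) := Square {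
  sqA : D;
  sqC : D;
  sqa : hom sqA X;
  sqp : hom sqA M;
  sqc : hom X sqC;
  sqj : hom M sqC;
  sq_cover_a : cover sqa;
  sq_hull_p : hull sqp;
  sq_hull_c : hull sqc;
  sq_cover_j : cover sqj;
  sq_comm : sqc \oc sqa = sqj \oc sqp
}.

(** The octahedron on [P -> A -> X], where [P -> A -> M] is the triangle of [p],
    produces [C] as the cone of the composite. *)
Lemma square_exists (X A M : D) (a : hom A X) (p : hom A M) :
  cover a -> hull p -> inhabited (square X M).
Proof.
move=> ca hp.
have [[tA [B [b [d [tB abd]]]]] [tM [P [q [e [tP qpe]]]]]] := (ca, hp).
have [C [c [k ck]]] := dist_ex (a \oc q).
have [j [v [jv jp _ _ _]]] := dist_oct qpe abd ck.
have tC : Dge t 0 C by apply: Dge0_ext jv tM _; exact: Dge1_ge0.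
have hc : hull c by split=> //; exists P, (a \oc q), k.
have cj : cover j.
  split; last by exists B, v; eexists; split; first by []; exact: jv.
  exact: Dle0_cone qpe (DleN1_le0 tP) tA.
by split; exact: Square ca hp hc cj (esym jp).
Qed.

Lemma H0_square (X : D) : inhabited (square X (incl (H0 t X))).
Proof.
have [a ca] := tau_cover X.
have [p hp] := tau_hull (tau_le0 t X).
exact: square_exists ca hp.
Qed.

(** A relation between maps, so that maps of the heart and maps between arbitrary
    squares are handled like those between the chosen objects [H0 X]. *)
Definition induced (X X' M M' : D) (r : square X M) (r' : square X' M')
    (f : hom X X') (phi : hom M M') : Prop :=
  sqj r' \oc phi \oc sqp r = sqc r' \oc f \oc sqa r.

Lemma square_ge0 (X M : D) (r : square X M) : Dge t 0 M.
Proof. exact: (sq_hull_p r).1. Qed.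

(** [sqp r] is epic towards degrees at least 0 and [sqj r'] is monic from degrees at
    most 0, so both can be cancelled. *)
Lemma induced_inj (X X' M M' : D) (r : square X M) (r' : square X' M')
    (f : hom X X') (phi psi : hom M M') :
  induced r r' f phi -> induced r r' f psi -> phi = psi.
Proof.
move=> phiE psiE; apply: (hull_epic (sq_hull_p r) (square_ge0 r')).
apply: (cover_monic (sq_cover_j r') (sq_cover_a r).1).
by rewrite !compA phiE psiE.
Qed.

(** Together with [induced_sqC], this says that induced maps may be computed on
    either truncation; the first serves cokernels and the second kernels. *)
Lemma induced_sqA (X X' M M' : D) (r : square X M) (r' : square X' M')
    (f : hom X X') (phi : hom M M') (u : hom (sqA r) (sqA r')) :
  sqa r' \oc u = f \oc sqa r ->
  induced r r' f phi <-> phi \oc sqp r = sqp r' \oc u.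
Proof.
move=> uE; have E : sqc r' \oc f \oc sqa r = sqj r' \oc (sqp r' \oc u).
  by rewrite -compA -uE compA sq_comm compA.
rewrite /induced E -compA; split=> [|-> //].
exact: (cover_monic (sq_cover_j r') (sq_cover_a r).1).
Qed.

Lemma induced_sqC (X X' M M' : D) (r : square X M) (r' : square X' M')
    (f : hom X X') (phi : hom M M') (v : hom (sqC r) (sqC r')) :
  v \oc sqc r = sqc r' \oc f ->
  induced r r' f phi <-> sqj r' \oc phi = v \oc sqj r.
Proof.
move=> vE; have E : sqc r' \oc f \oc sqa r = v \oc sqj r \oc sqp r.
  by rewrite -vE -compA sq_comm compA.
rewrite /induced E; split=> [|-> //].
exact: (hull_epic (sq_hull_p r) (sq_hull_c r').1).
Qed.

Lemma induced_exists (X X' M M' : D) (r : square X M) (r' : square X' M')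
    (f : hom X X') : exists phi, induced r r' f phi.
Proof.
have [u uE] := cover_lift (f \oc sqa r) (sq_cover_a r') (sq_cover_a r).1.
have [phi phiE] := hull_lift (sqp r' \oc u) (sq_hull_p r) (square_ge0 r').
by exists phi; apply/(induced_sqA phi uE).
Qed.

Lemma induced_comp (X X' X'' M M' M'' : D)
    (r : square X M) (r' : square X' M') (r'' : square X'' M'')
    (f : hom X X') (g : hom X' X'') (phi : hom M M') (psi : hom M' M'') :
  induced r r' f phi -> induced r' r'' g psi ->
  induced r r'' (g \oc f) (psi \oc phi).
Proof.
move=> fphi gpsi.
have [u uE] := cover_lift (f \oc sqa r) (sq_cover_a r') (sq_cover_a r).1.
move/(induced_sqA phi uE): fphi => phiE.
rewrite /induced !compA -(compA (sqj r'' \oc psi)) phiE compA gpsi.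
by rewrite -compA uE !compA.
Qed.

Lemma induced_id (X M : D) (r : square X M) : induced r r (idm X) (idm M).
Proof. by rewrite /induced !compm1 sq_comm. Qed.

Lemma induced_add (X X' M M' : D) (r : square X M) (r' : square X' M')
    (f g : hom X X') (phi psi : hom M M') :
  induced r r' f phi -> induced r r' g psi -> induced r r' (f + g) (phi + psi).
Proof. by move=> phiE psiE; rewrite /induced !(compDr, compDl) phiE psiE. Qed.

Lemma induced0 (X X' M M' : D) (r : square X M) (r' : square X' M') :
  induced r r' 0 0.
Proof. by rewrite /induced !(compm0, comp0m). Qed.

(** * Right and left exactness *)

(** The octahedron on [X -> A_Y -> Y] shows that the cone [C'] of [X -> A_Y] is
    the truncation of [Z] to degrees at most 0. So a map to an object in degrees at
    least 0 which vanishes on [X] factors through [C'], uniquely because the third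
    term [X[1]] of the triangle lies in degrees at most -1. *)
Lemma induced_cokernel (X Y Z MX MY MZ : D)
    (rX : square X MX) (rY : square Y MY) (rZ : square Z MZ)
    (f : hom X Y) (g : hom Y Z) (h : hom Z (sh D X)) (phi : hom MX MY) (psi : hom MY MZ) :
  dist f g h -> Dle0 t X -> induced rX rY f phi -> induced rY rZ g psi ->
  forall (T : D) (s : hom MY T), Dge t 0 T -> s \oc phi = 0 ->
  exists! w : hom MZ T, w \oc psi = s.
Proof.
move=> fgh tX fphi gpsi T s tT sphi0.
have cY := sq_cover_a rY; have [tAY [B [b [d [tB abd]]]]] := cY.
have [tAZ _] := sq_cover_a rZ; have [tAX _] := sq_cover_a rX.
have [f' f'E] := cover_lift f cY tX.
have [C' [g' [h' f'gh']]] := dist_ex f'.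
have fgh2 : dist (sqa rY \oc f') g h by rewrite f'E.
have [w [w2 [dw wg' _ _ _]]] := dist_oct f'gh' abd fgh2.
have tC' : Dle0 t C' by exact: Dle0_cone f'gh' tX tAY.
have cw : cover w by split=> //; exists B, w2; eexists; split; [|exact: dw].
have [v' v'E] := cover_lift w (sq_cover_a rZ) tC'.
have [e' e'E] := cover_lift (sqa rZ) cw tAZ.
have v'e' : v' \oc e' = idm _.
  by apply: (cover_monic (sq_cover_a rZ)) => //; rewrite compA v'E e'E compm1.
have vE : sqa rZ \oc (v' \oc g') = g \oc sqa rY by rewrite compA v'E wg'.
have ev : e' \oc (v' \oc g') = g'.
  by apply: (cover_monic cw) => //; rewrite compA e'E vE wg'.
move/(induced_sqA psi vE): gpsi => psiE.
have uE : sqa rY \oc (f' \oc sqa rX) = f \oc sqa rX by rewrite compA f'E.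
move/(induced_sqA phi uE): fphi => phiE.
have [e eE] := cover_lift (idm X) (sq_cover_a rX) tX.
have [s' s'E] : exists s', s' \oc g' = s \oc sqp rY.
  apply: dist_wcoker f'gh' _; rewrite -[f']compm1 -eE !compA.
  by rewrite -2!(compA s) -(compA (sqp rY)) -phiE compA sphi0 !comp0m.
have [m mE] := hull_lift (s' \oc e') (sq_hull_p rZ) tT.
have mpsi : m \oc psi = s.
  apply: (hull_epic (sq_hull_p rY) tT).
  by rewrite -compA psiE compA mE -compA ev s'E.
exists m; split=> // m' m'psi.
apply: (hull_epic (sq_hull_p rZ) tT).
rewrite -[sqp rZ]compm1 -v'e' !compA; congr (_ \oc e').
apply: (dist_epic f'gh') => [x|].
  by apply: (orthN1 x) tT; exact: Dle0_sh.
by rewrite -!compA -psiE !compA mpsi m'psi.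
Qed.

(** The dual argument, with the octahedron for fibres on [Y -> C_Y -> Z]. *)
Lemma induced_kernel (X Y Z MX MY MZ : D)
    (rX : square X MX) (rY : square Y MY) (rZ : square Z MZ)
    (f : hom X Y) (g : hom Y Z) (h : hom Z (sh D X)) (phi : hom MX MY) (psi : hom MY MZ) :
  dist f g h -> Dge t 0 Z -> induced rX rY f phi -> induced rY rZ g psi ->
  forall (T : D) (s : hom T MY), Dle0 t T -> psi \oc s = 0 ->
  exists! w : hom T MX, phi \oc w = s.
Proof.
move=> fgh tZ fphi gpsi T s tT psis0.
have hY := sq_hull_c rY; have [tCY [P [q [d [tP qcd]]]]] := hY.
have [tCZ _] := sq_hull_c rZ; have [tCX _] := sq_hull_c rX.
have [g' g'E] := hull_lift g hY tZ.
have [F [k [k' kgk']]] := dist_fiber g'.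
have fgh2 : dist f (g' \oc sqc rY) h by rewrite g'E.
have [w2 [w [dw _ kw]]] := dist_oct_fiber qcd kgk' fgh2.
have tF : Dge t 0 F by exact: Dge0_fiber kgk' tCY tZ.
have hw : hull w by split=> //; exists P, w2; eexists; split; [|exact: dw].
have [v' v'E] := hull_lift w (sq_hull_c rX) tF.
have [e' e'E] := hull_lift (sqc rX) hw tCX.
have e'v' : e' \oc v' = idm _.
  by apply: (hull_epic (sq_hull_c rX)) => //; rewrite -compA v'E e'E comp1m.
have vE : k \oc v' \oc sqc rX = sqc rY \oc f by rewrite -compA v'E kw.
have ve : k \oc v' \oc e' = k.
  by apply: (hull_epic hw) => //; rewrite -compA e'E vE kw.
move/(induced_sqC phi vE): fphi => phiE.
have uE : sqc rZ \oc g' \oc sqc rY = sqc rZ \oc g by rewrite -compA g'E.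
move/(induced_sqC psi uE): gpsi => psiE.
have [e eE] := hull_lift (idm Z) (sq_hull_c rZ) tZ.
have [s' s'E] : exists s', k \oc s' = sqj rY \oc s.
  apply: dist_wker kgk' _; rewrite -[g']comp1m -eE.
  rewrite -(compA e) -(compA e) (compA (_ \oc g')) -psiE.
  by rewrite -(compA (sqj rZ)) psis0 !compm0.
have [m mE] := cover_lift (e' \oc s') (sq_cover_j rX) tT.
have phim : phi \oc m = s.
  apply: (cover_monic (sq_cover_j rY) tT).
  by rewrite compA phiE -compA mE compA ve s'E.
exists m; split=> // m' phim'.
apply: (cover_monic (sq_cover_j rX) tT).
rewrite -[sqj rX]comp1m -e'v' -!compA; congr (e' \oc _).
apply: (dist_monic kgk') => [x|].
  by apply: (orthN1 x) tZ; exact: Dle0_sh.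
by rewrite !compA -phiE -!compA phim phim'.
Qed.

(** ** The heart *)

Lemma heart_le0 (M : heart t) : Dle0 t (incl M).
Proof. by apply/Dle0E; have [] := svalP M. Qed.

Lemma heart_ge0 (M : heart t) : Dge t 0 (incl M).
Proof. by have [] := svalP M. Qed.

(** An object of the heart is its own cohomology. *)
Definition heart_square (M : heart t) : square (incl M) (incl M) :=
  Square (cover_id (heart_le0 M)) (hull_id (heart_ge0 M))
         (hull_id (heart_ge0 M)) (cover_id (heart_le0 M)) erefl.

Lemma induced_heart (M N : heart t) (f : hom M N) :
  induced (heart_square M) (heart_square N) f f.
Proof. by []. Qed.

Lemma square_H0 (X : D) (M : heart t) : square X (incl M) -> isomorphic M (H0 t X).
Proof.
move=> r; have [r'] := H0_square X.
have [phi phiE] := induced_exists r r' (idm X).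
have [psi psiE] := induced_exists r' r (idm X).
exists phi, psi; split.
  apply: (@induced_inj _ _ _ _ r r (idm X)); last exact: induced_id.
  by rewrite -[idm X]comp1m; exact: induced_comp phiE psiE.
apply: (@induced_inj _ _ _ _ r' r' (idm X)); last exact: induced_id.
by rewrite -[idm X]comp1m; exact: induced_comp psiE phiE.
Qed.

Lemma heart_H0 (M : heart t) : isomorphic M (H0 t (incl M)).
Proof. exact: square_H0 (heart_square M). Qed.

Section Exactness.
Variables (X Y Z : D) (MX MY MZ : heart t).
Variables (rX : square X (incl MX)) (rY : square Y (incl MY))
  (rZ : square Z (incl MZ)).
Variables (f : hom X Y) (g : hom Y Z) (h : hom Z (sh D X)).
Variables (phi : hom MX MY) (psi : hom MY MZ).
Hypotheses (fgh : dist f g h) (fphi : induced rX rY f phi)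
  (gpsi : induced rY rZ g psi).

Let psiphi0 : psi \oc phi = 0.
Proof.
apply: (@induced_inj _ _ _ _ rX rZ (g \oc f)); first exact: induced_comp fphi gpsi.
by rewrite (dist_comp0 fgh); exact: induced0.
Qed.

Lemma heart_cokernel : Dle0 t X -> is_cokernel phi psi.
Proof.
move=> tX; split=> // T s s0.
exact: (induced_cokernel fgh tX fphi gpsi (heart_ge0 T) s0).
Qed.

Lemma heart_kernel : Dge t 0 Z -> is_kernel psi phi.
Proof.
move=> tZ; split=> // T s s0.
exact: (induced_kernel fgh tZ fphi gpsi (heart_le0 T) s0).
Qed.

End Exactness.

(** * The cohomological functor *)

Definition H0sq (X : D) : square X (incl (H0 t X)) := inhabited_witness (H0_square X).

Definition H0map (X Y : D) (f : hom X Y) : hom (H0 t X) (H0 t Y) :=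
  sval (cid (induced_exists (H0sq X) (H0sq Y) f)).

Lemma H0mapP (X Y : D) (f : hom X Y) : induced (H0sq X) (H0sq Y) f (H0map f).
Proof. exact: (svalP (cid (induced_exists (H0sq X) (H0sq Y) f))). Qed.

Lemma H0map_id (X : D) : H0map (idm X) = idm (H0 t X).
Proof. exact: induced_inj (H0mapP _) (induced_id _). Qed.

Lemma H0map_comp (X Y Z : D) (g : hom Y Z) (f : hom X Y) :
  H0map (g \oc f) = H0map g \oc H0map f.
Proof. exact: induced_inj (H0mapP _) (induced_comp (H0mapP _) (H0mapP _)). Qed.

Lemma H0map_add (X Y : D) (f g : hom X Y) : H0map (f + g) = H0map f + H0map g.
Proof. exact: induced_inj (H0mapP _) (induced_add (H0mapP _) (H0mapP _)). Qed.

Definition H0F : add_functor D (heart t) :=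
  AddFunctor H0map_id H0map_comp H0map_add.

Lemma H0_cokernel (X Y Z : D) (f : hom X Y) (g : hom Y Z) (h : hom Z (sh D X)) :
  dist f g h -> Dle0 t X -> is_cokernel (fmap H0F f) (fmap H0F g).
Proof. by move=> fgh; apply: heart_cokernel fgh (H0mapP _) (H0mapP _). Qed.

Lemma H0_kernel (X Y Z : D) (f : hom X Y) (g : hom Y Z) (h : hom Z (sh D X)) :
  dist f g h -> Dge t 0 Z -> is_kernel (fmap H0F g) (fmap H0F f).
Proof. by move=> fgh; apply: heart_kernel fgh (H0mapP _) (H0mapP _). Qed.

Lemma H0_zero_DleN1 (X : D) : Dle t (-1) X -> zero_obj (H0 t X).
Proof.
move=> tX; apply/zero_objP; rewrite -H0map_id.
apply: induced_inj (H0mapP _) _.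
rewrite /induced compm0 comp0m (orthN1 (sqc (H0sq X)) tX (sq_hull_c (H0sq X)).1).
by rewrite !comp0m.
Qed.

Lemma H0_zero_Dge1 (X : D) : Dge1 t X -> zero_obj (H0 t X).
Proof.
move=> tX; apply/zero_objP; rewrite -H0map_id.
apply: induced_inj (H0mapP _) _.
rewrite /induced compm0 comp0m (t_orth (sqa (H0sq X)) (sq_cover_a (H0sq X)).1 tX).
by rewrite compm0.
Qed.

(** In the long exact sequence of a triangle, [H0 Z] is an extension of the kernel
    of [H0 X[1] -> H0 Y[1]] by the cokernel of [H0 X -> H0 Y]. With [A]
    the truncation of [X] to degrees at most 0 and [B'] that of [Y] to degrees at
    least 1, the two ends are [H0 Z1] and [H0 Z2] for the cones [Z1] of [A -> X -> Y]
    and [Z2] of [X -> Y -> B']. Octahedra give maps [Z1 -> Z -> Z2], which need not be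
    part of a triangle but become a short exact sequence under [H0]. *)
Lemma H0_cone (W : set (heart t)) (X Y Z : D)
    (f : hom X Y) (g : hom Y Z) (h : hom Z (sh D X)) :
  wide W -> dist f g h -> W (H0 t X) -> W (H0 t Y) ->
  W (H0 t (sh D X)) -> W (H0 t (sh D Y)) -> W (H0 t Z).
Proof.
move=> wW fgh WX WY WX1 WY1.
have W0 := subcat_zero_obj (wide_subcat wW).
have [a [tA [B [b [d [tB abd]]]]]] := tau_cover X.
have [a' [tA' [B' [b' [d' [tB' abd']]]]]] := tau_cover Y.
have [Z1 [y1 [h1 fah]]] := dist_ex (f \oc a).
have [u1 [v1 [du1 _ _ v1y1 _]]] := dist_oct abd fgh fah.
have [Z2 [e [k bfk]]] := dist_ex (b' \oc f).
have [u2 [v2 [du2 _ ku2 _ _]]] := dist_oct fgh ((dist_rot _ _ _).1 abd') bfk.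
have tB1 := Dge1_sh tB; have tB1' := Dge1_sh tB'.
(* [H0 Z1] is the kernel of [H0 Z -> H0 B[1]]. *)
have ker1 := H0_kernel ((dist_rot _ _ _).1 du1) tB1.
(* [A' -> Y -> Z] factors through [Z1], so that this also computes the cokernel
   of [H0 Z1 -> H0 Z]. *)
have cok2 : is_cokernel (fmap H0F (g \oc a')) (fmap H0F u2).
  apply: (H0_cokernel (h := v2)) tA'; apply/dist_rot.
  by rewrite fmap_comp -compmN.
have kerk := H0_kernel ((dist_rot _ _ _).1 ((dist_rot _ _ _).1 bfk)) tB1'.
have W1 : W (H0 t Z1).
  apply: (wide_coker wW (H0_cokernel fah tA)) WY.
  apply: (wide_ker wW (H0_kernel abd (Dge1_ge0 tB))) WX _.
  exact/W0/H0_zero_Dge1.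
have W2 : W (H0 t Z2).
  apply: (wide_ker wW kerk) WX1 _.
  apply: (wide_coker wW (H0_cokernel ((dist_sh _ _ _).1 abd') (Dle0_shift tA'))) WY1.
  exact/W0/H0_zero_DleN1/Dle0_sh.
apply: (wide_ext wW (f := fmap H0F v1) (g := fmap H0F u2)) W1 W2.
(* This lets vanishing in [H0 Z2] be tested in [H0 B[1]], where [ker1] applies. *)
have monic_bk (T : heart t) (s : hom T (H0F Z2)) :
    fmap H0F (fmap (sh D) b \oc k) \oc s = 0 -> s = 0.
  rewrite fmap_comp -compA => /(H0_kernel ((dist_sh _ _ _).1 abd) tB1).2 [w [wE _]].
  have {}wE : fmap H0F k \oc s = 0.
    by rewrite -wE ((H0_zero_DleN1 (Dle0_sh tA) T).1 w) compm0.
  have [|w' [_ w'U]] := kerk.2 T 0; first by rewrite compm0.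
  by rewrite -(w'U s wE) (w'U 0 (compm0 _ _)).
have bh : fmap (sh D) b \oc h = fmap (sh D) b \oc k \oc u2 by rewrite -compA ku2.
split; split.
- apply: monic_bk; rewrite -!fmap_comp compA -bh.
  by rewrite (dist_comp0 ((dist_rot _ _ _).1 du1)) fmap0.
- move=> T s u2s; apply: ker1.2.
  by rewrite bh fmap_comp -compA u2s compm0.
- apply: monic_bk; rewrite -!fmap_comp compA -bh.
  by rewrite (dist_comp0 ((dist_rot _ _ _).1 du1)) fmap0.
- move=> T s sv1; apply: cok2.2.
  by rewrite -v1y1 !fmap_comp !compA sv1 !comp0m.
Qed.

End Aisles.

(** * From wide to thick subcategories *)

Section Correspondence.
Variables (D : triangulated) (t : tstructure D).

Lemma H0_iso (X Y : D) : isomorphic X Y -> isomorphic (H0 t X) (H0 t Y).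
Proof. exact: (@fmap_isomorphic _ _ (H0F t)). Qed.

Lemma iso_incl (M N : heart t) : isomorphic M N -> isomorphic (incl M) (incl N).
Proof. by move=> [f [g [gf fg]]]; exists f, g. Qed.

Lemma direct_sum_incl (M N S : heart t) :
  direct_sum M N S -> direct_sum (incl M) (incl N) (incl S).
Proof. by move=> [i1 [i2 [p1 [p2 E]]]]; exists i1, i2, p1, p2. Qed.

Lemma Dle0_shift_nat (n : nat) (X : D) : Dle0 t X -> Dle0 t (shift n X).
Proof. by move=> tX; elim: n => //= n; exact: Dle0_shift. Qed.

Section Tilde.
Variables (W : set (heart t)) (wW : wide W).

Let W_iso (M N : heart t) : isomorphic M N -> W M -> W N.
Proof. exact: subcat_iso (wide_subcat wW) _ _. Qed.

Lemma tilde_iso (X Y : D) : isomorphic X Y -> tilde t W X -> tilde t W Y.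
Proof. by move=> XY WX k; apply: W_iso (WX k); exact/H0_iso/iso_shift. Qed.

Lemma tilde_thick : thick (tilde t W).
Proof.
split; first split.
- exact: tilde_iso.
- have [[O O0] _] := tcat_additive D; exists O => // k.
  apply: subcat_zero_obj (wide_subcat wW) _.
  exact: (fmap_zero_obj (H0F t) (zero_obj_shift k O0)).
- move=> X Y S XYS WX WY k; apply: (subcat_sum (wide_subcat wW) _ (WX k) (WY k)).
  exact: (fmap_direct_sum (H0F t) (direct_sum_shift k XYS)).
- move=> n X WX k; apply: W_iso (WX (k + n)).
  exact/H0_iso/isomorphic_sym/shift_add.
- move=> X Y Z f g h fgh WX WY k.
  have [|f' [g' [h' fgh']]] := @triangle_on_shift _ k X Y Z; first by exists f, g, h.
  apply: (H0_cone wW fgh' (WX k) (WY k)).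
    by apply: W_iso (WX (k + 1)); exact/H0_iso/shift_succ.
  by apply: W_iso (WY (k + 1)); exact/H0_iso/shift_succ.
- move=> X Y S XYS WS k.
  have := fmap_direct_sum (H0F t) (direct_sum_shift k XYS).
  by move/direct_sum_kernel => [e [i ki]]; exact: (wide_ker wW ki (WS k) (WS k)).
Qed.

(** The cohomology of an object of the heart vanishes outside degree 0. *)
Lemma tilde_incl (M : heart t) : tilde t W (incl M) <-> W M.
Proof.
split=> [/(_ 0)|WM]; first exact/W_iso/isomorphic_sym/heart_H0.
have W0 := subcat_zero_obj (wide_subcat wW).
case=> [[|n]|n]; first by apply: W_iso WM; exact: heart_H0.
  by apply/W0/H0_zero_DleN1/Dle0_sh/Dle0_shift_nat/heart_le0.
apply/W0/H0_zero_Dge1; rewrite /shift; elim: n => [|n IH].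
  have /Dge0E[Y tY MY] := heart_ge0 M.
  apply: (subcat_iso (Dge1_subcat t) _ tY); apply: isomorphic_sym.
  exact: iso_trans (fmap_isomorphic _ MY) (shV_sh_iso _).
exact: Dge1_shift IH.
Qed.

Lemma tilde_homology_determined : homology_determined t (tilde t W).
Proof.
move=> X; split=> WX k.
  exact/(thick_shift_sub tilde_thick)/tilde_incl.
by apply/tilde_incl/(thick_shift_sub tilde_thick)/WX.
Qed.

Lemma H0_sub_tilde : H0_sub t (tilde t W) = W.
Proof.
apply/seteqP; split=> M /=.
  by move=> [X /(_ 0) WX MX]; apply: W_iso (isomorphic_sym MX) WX.
by move=> WM; exists (incl M); [exact/tilde_incl | exact: heart_H0].
Qed.

End Tilde.

(** * From thick to wide subcategories *)

Section Stable.
Variables (E : set D) (sE : H0_stable t E) (tE : thick E).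

Lemma H0_sub_incl (M : heart t) : H0_sub t E M <-> E (incl M).
Proof.
split=> [[X EX MX]|EM]; last by exists (incl M) => //; exact: heart_H0.
exact: (thick_iso tE (iso_incl (isomorphic_sym MX)) (sE EX)).
Qed.

(** The kernel of a monomorphism [f] of the heart is [H0 F] for the fibre [F] of
    [f], which lies in degrees at least 0; it vanishes, so that [F] lies in degrees
    at least 1 and its shift, the cone of [f], in the heart. *)
Lemma short_exact_dist (X Y Z : heart t) (f : hom X Y) (g : hom Y Z) :
  short_exact f g -> exists h : hom (incl Z) (sh D (incl X)),
    @dist D (incl X) (incl Y) (incl Z) f g h.
Proof.
move=> [[gf0 kf] cg].
have [C [c [d fcd]]] := dist_ex (f : hom (incl X) (incl Y)).
have [F [i [e ife]]] := dist_fiber (f : hom (incl X) (incl Y)).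
have tF : Dge t 0 F := Dge0_fiber ife (heart_ge0 X) (heart_ge0 Y).
have [r] := H0_square t F.
have [phi phiE] := induced_exists r (heart_square X) i.
have keri := heart_kernel ife phiE (induced_heart f) (heart_ge0 Y).
have phi0 : phi = 0.
  have [w [_ wU]] := kf _ (0 : hom (H0 t F) Y) (compm0 _ _).
  by rewrite -(wU phi keri.1) (wU 0 (compm0 _ _)).
have H0F0 : zero_obj (H0 t F).
  apply/zero_objP; have [w [_ wU]] := keri.2 _ (0 : hom (H0 t F) X) (compm0 _ _).
  by rewrite -(wU (idm _)) ?(wU 0) // phi0 comp0m.
have tF1 : Dge1 t F.
  apply: Dge1_of_orth => S s tS.
  have [x xE] := hull_lift (idm F) (sq_hull_c r) tF.
  have [u uE] := cover_lift (sqc r \oc s) (sq_cover_j r) tS.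
  rewrite -[s]comp1m -xE -compA -uE.
  have z : idm (incl (H0 t F)) = 0 := (zero_objP _).1 H0F0.
  by rewrite -[u]comp1m z comp0m !compm0.
have tC0 : Dge t 0 C.
  apply: Dge0_iso (Dge1_sh tF1).
  exact: cone_unique ((dist_rot _ _ _).1 ife) fcd.
have tC : Dle0 t C := Dle0_cone fcd (heart_le0 X) (heart_le0 Y).
pose N : heart t := exist _ C (conj ((Dle0E t C).2 tC) tC0).
have cN : @is_cokernel (heart t) X Y f N c.
  exact: (heart_cokernel (MZ := N) fcd (induced_heart f)
    (induced_heart (N := N) c) (heart_le0 X)).
have [u [u' [u'u uu']] ucg] := cokernel_unique cN cg.
have uI : @is_iso D (incl N) (incl Z) u by exists u'.
have [h fgh] := dist_replace_cone uI fcd.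
by exists h; rewrite -ucg.
Qed.

(** Kernels and cokernels in the heart are [H0] of the fibre and of the cone, to which
    stability under [H0] applies; extensions come from [short_exact_dist]. *)
Lemma H0_sub_wide : wide (H0_sub t E).
Proof.
split; first split.
- move=> M N MN /H0_sub_incl EM; apply/H0_sub_incl.
  exact: (thick_iso tE (iso_incl MN)).
- have [Z Z0 EZ] := subcat_zero (thick_subcat tE).
  exists (H0 t Z); first exact: (fmap_zero_obj (H0F t) Z0).
  by apply/H0_sub_incl/sE.
- move=> M N S MNS /H0_sub_incl EM /H0_sub_incl EN; apply/H0_sub_incl.
  exact: (subcat_sum (thick_subcat tE) (direct_sum_incl MNS) EM EN).
- move=> X Y Z f g /short_exact_dist[h fgh] /H0_sub_incl EX /H0_sub_incl EZ.
  by apply/H0_sub_incl; exact: (thick_middle tE fgh).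
- move=> X Y f K k fk /H0_sub_incl EX /H0_sub_incl EY.
  have [F [i [e ife]]] := dist_fiber (f : hom (incl X) (incl Y)).
  have [r] := H0_square t F.
  have [phi phiE] := induced_exists r (heart_square X) i.
  have keri := heart_kernel ife phiE (induced_heart f) (heart_ge0 Y).
  apply/H0_sub_incl; apply: (thick_iso tE (iso_incl (kernel_unique keri fk))).
  by apply: sE; exact: (thick_fiber tE ife).
- move=> X Y f Q q fq /H0_sub_incl EX /H0_sub_incl EY.
  have [C [c [d fcd]]] := dist_ex (f : hom (incl X) (incl Y)).
  have [r] := H0_square t C.
  have [psi psiE] := induced_exists (heart_square Y) r c.
  have cokc := heart_cokernel fcd (induced_heart f) psiE (heart_le0 X).
  have [u uI _] := cokernel_unique cokc fq.
  apply/H0_sub_incl; apply: (thick_iso tE (iso_incl (ex_intro _ u uI))).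
  by apply: sE; exact: (thick_cone tE fcd).
Qed.

Lemma H0_stable_Hn (X : D) (k : int) : E X -> E (incl (Hn t k X)).
Proof. by move=> EX; apply: sE; exact/(thick_shiftE tE). Qed.

Lemma shift_orth (N : nat) (S Y : D) (f : hom (shift N S) (shift N Y)) :
  Dle0 t S -> Dge1 t Y -> f = 0.
Proof.
elim: N f => [|N IH] f tS tY; first exact: t_orth f tS tY.
by have [f' <-] := sh_full f; rewrite (IH f' tS tY) fmap0.
Qed.

(** Induction on the amplitude: splitting off [H0 X] leaves the part [P] of [X] in
    degrees at most -1, and [P[-1]] satisfies the hypotheses again because
    [tilde t (H0_sub t E)] is thick. The bound below is stated by orthogonality,
    which passes to [P[-1]] along [P -> X]. *)
Lemma stable_amplitude (N : nat) (X : D) : Dle0 t X ->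
  (forall (S : D) (f : hom (shift N S) X), Dle0 t S -> f = 0) ->
  tilde t (H0_sub t E) X -> E X.
Proof.
have tT := tilde_thick H0_sub_wide.
elim: N X => [|N IH] X tX oX WX.
  by apply: subcat_zero_obj (thick_subcat tE) _; apply/zero_objP; exact: oX.
have WM : H0_sub t E (H0 t X) := WX 0.
have [[A C a p c j ca hp hc cj cajp]] := H0_square t X.
(* [X] lies in degrees at most 0, so it may be replaced by its truncation [A]. *)
have aI : is_iso a.
  have [e ae] := cover_lift (idm X) ca tX; exists e; split=> //.
  by apply: (cover_monic ca ca.1); rewrite compA ae comp1m compm1.
have AX : isomorphic A X by exists a.
have [tM [P [q [d [tP qpd]]]]] := hp.
have WP : tilde t (H0_sub t E) P.
  apply: (thick_fiber tT qpd); first exact: (thick_iso tT (isomorphic_sym AX) WX).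
  exact/(tilde_incl H0_sub_wide).
have /DleN1E[P' tP' PP'] := tP.
have [i iI] := isomorphic_sym PP'.
apply: (thick_iso tE AX); apply: (thick_middle tE qpd); last exact/H0_sub_incl.
apply: (thick_iso tE (isomorphic_sym PP')); apply/(thick_shiftE tE 1)/IH => //.
  move=> S f tS; apply: sh_faithful; apply: (iso_monic iI).
  rewrite fmap0 compm0; apply: (dist_monic qpd) => [v|].
    by apply: (orthN1 v) tM; apply/Dle0_sh/(Dle0_shift_nat N.+1).
  rewrite compm0; apply: (iso_monic aI); rewrite compm0.
  exact: (oX S (a \oc (q \oc (i \oc fmap (sh D) f)))).
exact: ((thick_shiftE tT 1 P').1 (thick_iso tT PP' WP)).
Qed.

(** A shift moves [X] into degrees at most 0; boundedness below is then the
    orthogonality used by [stable_amplitude]. *)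
Lemma stable_bounded (X : D) : bounded t -> tilde t (H0_sub t E) X -> E X.
Proof.
move=> [bl bg] WX.
have [n _ [Y tY XY]] : (\bigcup_n Dle t n) X by rewrite bl.
have [m _ [Z tZ XZ]] : (\bigcup_n Dge t n) X by rewrite bg.
have nXZ : isomorphic (shift n X) (shift (n + (1 - m)) Z).
  exact: iso_trans (iso_shift n XZ) (shift_add _ _ _).
apply/(thick_shiftE tE n).
have tX : Dle0 t (shift n X).
  apply: (subcat_iso (Dle0_subcat t) _ tY); apply: isomorphic_sym.
  exact: iso_trans (iso_shift n XY) (shiftK _ _).
have {}WX : tilde t (H0_sub t E) (shift n X).
  exact: (thick_shift (tilde_thick H0_sub_wide) n WX).
have [e eI] := nXZ.
case: (n + (1 - m)) e eI => N e eI; [apply: (stable_amplitude (N := N)) => // | 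
  apply: (stable_amplitude (N := 0)) => //] => S f tS;
  apply: (iso_monic eI); rewrite compm0; first exact: shift_orth.
apply: t_orth tS _; rewrite /shift; elim: N.+1 => //= k; exact: Dge1_shift.
Qed.

End Stable.

(** * The correspondence *)

Lemma homology_determined_stable (E : set D) :
  homology_determined t E -> thick E -> H0_stable t E.
Proof. by move=> hE tE X /hE/(_ 0)/(thick_shift_sub tE). Qed.

Lemma tilde_H0_sub (E : set D) :
  homology_determined t E -> thick E -> tilde t (H0_sub t E) = E.
Proof.
move=> hE tE; have sE := homology_determined_stable hE tE.
apply/seteqP; split=> X /= EX.
  by apply/hE => k; apply/(thick_shift_sub tE)/(H0_sub_incl sE tE)/EX.
by move=> k; apply/(H0_sub_incl sE tE)/(thick_shift_sub tE); exact: (hE X).1.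
Qed.

End Correspondence.

Theorem corollary4p7 (D : triangulated) (t : tstructure D) :
  let wides : set (set (heart t)) := [set W | wide W] in
  let hd_thicks : set (set D) := [set E | homology_determined t E /\ thick E] in
  let H0_stable_thicks : set (set D) := [set E | H0_stable t E /\ thick E] in
  [/\ set_bij wides hd_thicks (tilde t),
      set_bij hd_thicks wides (H0_sub t),
      (forall W, wides W -> H0_sub t (tilde t W) = W),
      (forall E, hd_thicks E -> tilde t (H0_sub t E) = E) &
      bounded t -> hd_thicks = H0_stable_thicks].
Proof.
move=> wides hd_thicks H0_stable_thicks.
have HT W : wides W -> H0_sub t (tilde t W) = W by exact: H0_sub_tilde.
have TH E : hd_thicks E -> tilde t (H0_sub t E) = E by case; exact: tilde_H0_sub.
have tildeP W : wides W -> hd_thicks (tilde t W).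
  by move=> wW; split; [exact: tilde_homology_determined | exact: tilde_thick].
have H0_subP E : hd_thicks E -> wides (H0_sub t E).
  by move=> [hE tE]; apply: H0_sub_wide (homology_determined_stable hE tE) tE.
split=> //.
- split=> // [W W' /set_mem wW /set_mem wW' WW'|E hE].
    by rewrite -[W]HT // WW' HT.
  by exists (H0_sub t E); [exact: H0_subP | exact: TH].
- split=> // [E E' /set_mem hE /set_mem hE' EE'|W wW].
    by rewrite -[E]TH // EE' TH.
  by exists (tilde t W); [exact: tildeP | exact: HT].
move=> bt; apply/seteqP; split=> E [hE tE]; split=> //.
  exact: homology_determined_stable.
move=> X; split=> EX.
  by move=> k; apply/(thick_shift_sub tE)/(H0_stable_Hn hE tE).
apply: (stable_bounded hE tE bt) => k.
exact/(H0_sub_incl hE tE)/(thick_shift_sub tE)/EX.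
Qed.
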